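(* Let $n\ge 3$ and $2\le k\le n-1$. The Bernoulli $(n,k)$-hyperplane percolation model on $\mathbb{Z}^n$ undergoes a non-trivial phase transition, that is: if all the parameters $p_I$, $I\in\mathcal{I}(k;n)$, of $\mathbf{p}$ are sufficiently close to $1$, then $\mathbb{P}_{\mathbf{p}}(o\leftrightarrow\infty)>0$; on the other hand, when all the parameters of $\mathbf{p}$ are sufficiently close to $0$, then $\mathbb{P}_{\mathbf{p}}(o\leftrightarrow\infty)=0$. (Here ''sufficiently close'' means: there is $\delta=\delta(n,k)\in(0,1)$ such that the first conclusion holds whenever $p_I>1-\delta$ for all $I$, and the second whenever $p_I<\delta$ for all $I$.)
   Context: Let $[n]=\{1,\dots,n\}$ and $\mathcal{I}=\mathcal{I}(k;n)=\{I\subset[n]:\#I=k\}$. For $I\in\mathcal{I}$ let $\mathbb{Z}^k_I=\{\sum_{i\in I}x_ie_i: x_i\in\mathbb{Z}\}\subset\mathbb{Z}^n$ and let $\pi_I:\mathbb{Z}^n\to\mathbb{Z}^k_I$ be the orthogonal projection $\pi_I(\sum_{i=1}^n x_ie_i)=\sum_{i\in I}x_ie_i$. Given $\mathbf{p}=(p_I)_{I\in\mathcal{I}}\in[0,1]^{\mathcal{I}}$, let $\omega_I=(\omega_I(u))_{u\in\mathbb{Z}^k_I}$ be i.i.d. Bernoulli random variables with mean $p_I$, the families $\omega_I$, $I\in\mathcal{I}$, being independent of each other. The Bernoulli $(n,k)$-hyperplane percolation is the process $\omega\in\{0,1\}^{\mathbb{Z}^n}$, $\omega(v)=\prod_{I\in\mathcal{I}}\omega_I(\pi_I(v))$,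 and $\mathbb{P}_{\mathbf{p}}$ denotes its law. A site $v$ is $\omega$-open if $\omega(v)=1$. Sites are adjacent in $\mathbb{Z}^n$ if they are at Euclidean distance $1$. With $o$ the origin, $[o\leftrightarrow\infty]$ is the event that $o$ belongs to an infinite connected component of $\omega$-open sites. *)

(* Defs.v *)
From mathcomp Require Import all_boot all_order all_algebra.
From mathcomp Require Import all_classical all_reals all_analysis.

Set Implicit Arguments.
Unset Strict Implicit.
Unset Printing Implicit Defensive.

Import Order.TTheory GRing.Theory Num.Theory.

Local Open Scope classical_set_scope.
Local Open Scope ring_scope.

Section independence.
Context d (T : measurableType d) (R : realType) (P : probability T R).

(* Independence of an arbitrary family of set systems: the product rule holds
   on every finite subfamily, [s] listing its pairwise distinct indices. *)
Definition mutually_independent (J : choiceType) (F : J -> set (set T)) : Prop :=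
  forall (s : seq J) (A : J -> set T), uniq s ->
    (forall j, j \in s -> F j (A j)) ->
    P (\bigcap_(j in [set` s]) A j) = (\prod_(j <- s) P (A j))%E.

Definition sigma_RV d' (T' : measurableType d') (X : {RV P >-> T'}) :
    set (set T) :=
  preimage_set_system setT X measurable.

Definition sigma_RVs d' (T' : measurableType d') (J : Type)
    (X : J -> {RV P >-> T'}) : set (set T) :=
  <<s \bigcup_(j in setT) sigma_RV (X j) >>.

End independence.

(* [n] is 'I_n, and Z^n is 'rV[int]_n. *)
Definition ksubset (k n : nat) := {I : {set 'I_n} | #|I| == k}.

Definition supported (n : nat) (I : {set 'I_n}) (u : 'rV[int]_n) : bool :=
  [forall i, (i \notin I) ==> (u 0 i == 0)].

(* Z^k_I when #|I| = k. *)
Definition sublattice (n : nat) (I : {set 'I_n}) :=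
  {u : 'rV[int]_n | supported I u}.

Lemma supported_coord_proj (n : nat) (I : {set 'I_n}) (v : 'rV[int]_n) :
  supported I (\row_i (if i \in I then v 0 i else 0)).
Proof.
by apply/forallP => i; apply/implyP => /negbTE iI; rewrite mxE iI.
Qed.

Definition coord_proj (n : nat) (I : {set 'I_n}) (v : 'rV[int]_n) :
    sublattice I :=
  exist (fun u => supported I u) _ (supported_coord_proj I v).

Section hyperplane_percolation.
Context d (T : measurableType d) (R : realType) (P : probability T R).
Variables (k n : nat).

(* The last field, together with the second one, says that all the variables
   [omega I u] are mutually independent. *)
Record hyperplane_environment (p : ksubset k n -> R)
    (omega : forall I : ksubset k n, sublattice (val I) -> {RV P >-> bool}) :
    Prop := HyperplaneEnvironment {
  environment_bernoulli : forall I u,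
    distribution P (omega I u) =1 bernoulli_prob (p I) ;
  environment_indep : forall I,
    mutually_independent P (fun u => sigma_RV (omega I u)) ;
  environment_indep_families :
    mutually_independent P (fun I => sigma_RVs (omega I)) }.

(* {0,1} is bool, so that the product over I is a conjunction. *)
Definition hyperplane_percolation
    (omega : forall I : ksubset k n, sublattice (val I) -> {RV P >-> bool})
    (t : T) (v : 'rV[int]_n) : bool :=
  \big[andb/true]_(I : ksubset k n) omega I (coord_proj (val I) v) t.

End hyperplane_percolation.

(* Euclidean distance 1, through the squared distance. *)
Definition site_adjacent (n : nat) (x y : 'rV[int]_n) : bool :=
  \sum_(i < n) (x 0 i - y 0 i) ^+ 2 == 1.

(* [eta] is a configuration in {0,1}^(Z^n); the cluster of a closed site is
   empty. *)
Definition open_cluster (n : nat) (eta : 'rV[int]_n -> bool) (x : 'rV[int]_n) :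
    set 'rV[int]_n :=
  [set y | exists s : seq 'rV[int]_n,
     [/\ path (@site_adjacent n) x s, last x s = y & all eta (x :: s)]].

Definition origin_percolates (n : nat) (eta : 'rV[int]_n -> bool) : Prop :=
  infinite_set (open_cluster eta 0).

(* Main.v *)
Require Import Defs.
From mathcomp Require Import all_boot all_order all_algebra.
From mathcomp Require Import all_classical all_reals all_analysis.
From mathcomp Require Import zify ring lra.

(** Small parameters: a path of open sites projects, for each I, to a path (with
    pauses) of open sites of omega_I, and an infinite cluster has arbitrarily
    long self-avoiding projections for some I. There are at most (2n)^N walks of
    length N, each of which is open with probability at most delta^(N+1).

    Parameters close to 1: map the quarter plane N^2 to Z^n by
    (s, t) |-> s (1, ..., 1) + t (0, 1, ..., n - 1), and call a point of N^2
    good when all the sites of the box of side n at its image are open. As k >= 2,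
    points of N^2 at distance more than r = 2 n^2 depend on disjoint sets of
    variables omega_I(u), and neighbouring good points have connected images.
    Percolation of the good points follows from a multi-scale argument that
    involves no planar duality. A block of level j + 1 consists of M x M blocks
    of level j, M = 2 r + 3, and is good when its bad sub-blocks are pairwise at
    distance at most r. Then all but few of its rows and columns consist of good
    sub-blocks, they form its connected core, and the cores of neighbouring good
    blocks are connected to each other. A bad block of level j contains 2^j bad
    points that are pairwise far apart, so that the probability of badness is at
    most q_j, with q_(j+1) = M^4 q_j^2. With positive probability all the blocks
    of level j at (a, 0), a < M, are good for all j, and the origin then lies in
    an infinite cluster. *)

Set Implicit Arguments.
Unset Strict Implicit.
Unset Printing Implicit Defensive.

Import Order.TTheory GRing.Theory Num.Theory.

(** * Good blocks in the quarter plane and the connectivity of their cores *)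

Definition near_nat (r a b : nat) := (a <= b + r) && (b <= a + r).

Definition near_block (r : nat) (u v : nat * nat) :=
  near_nat r u.1 v.1 && near_nat r u.2 v.2.

(** The least side that leaves room for three indices pairwise more than [r] apart. *)
Definition scale (r : nat) := r.*2.+3.

Definition subblock (r : nat) (z : nat * nat) (a b : nat) : nat * nat :=
  (scale r * z.1 + a, scale r * z.2 + b).

Section good_blocks.
Variables (r : nat) (g : nat * nat -> bool).
Local Notation M := (scale r).

Fixpoint good_block (j : nat) (z : nat * nat) : bool :=
  if j is j'.+1 then
    [forall u : 'I_M * 'I_M, forall v : 'I_M * 'I_M,
      [|| good_block j' (subblock r z u.1 u.2),
          good_block j' (subblock r z v.1 v.2) |
          near_block r (val u.1, val u.2) (val v.1, val v.2)]]
  else g z.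

Definition good_row j z b := [forall a : 'I_M, good_block j (subblock r z a b)].
Definition good_col j z a := [forall b : 'I_M, good_block j (subblock r z a b)].

Fixpoint core (j : nat) (z x : nat * nat) : Prop :=
  if j is j'.+1 then
    exists a b : 'I_M, (good_row j' z b || good_col j' z a) /\
      core j' (subblock r z a b) x
  else x = z.

Lemma good_block_near j z (a b a' b' : 'I_M) : good_block j.+1 z ->
  ~~ good_block j (subblock r z a b) -> ~~ good_block j (subblock r z a' b') ->
  near_nat r a a' && near_nat r b b'.
Proof.
move=> /forallP/(_ (a, b))/forallP/(_ (a', b')) /=.
by case/or3P => [h /negP|h _ /negP|].
Qed.

Lemma good_rowN_near j z (b b' : 'I_M) : good_block j.+1 z ->
  ~~ good_row j z b -> ~~ good_row j z b' -> near_nat r b b'.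
Proof.
move=> gz /forallPn[a ha] /forallPn[a' ha'].
by have /andP[] := good_block_near gz ha ha'.
Qed.

Lemma good_colN_near j z (a a' : 'I_M) : good_block j.+1 z ->
  ~~ good_col j z a -> ~~ good_col j z a' -> near_nat r a a'.
Proof.
move=> gz /forallPn[b hb] /forallPn[b' hb'].
by have /andP[] := good_block_near gz hb hb'.
Qed.

(* Among the three indices 0, r + 1, 2r + 2, which are pairwise more than r
   apart, each of two sets of pairwise near indices misses at least two. *)
Lemma common_index (P Q : pred 'I_M) :
  (forall a b, ~~ P a -> ~~ P b -> near_nat r a b) ->
  (forall a b, ~~ Q a -> ~~ Q b -> near_nat r a b) ->
  exists a : 'I_M, P a && Q a.
Proof.
have h0 : 0 < M by rewrite /scale; lia.
have h1 : r.+1 < M by rewrite /scale; lia.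
have h2 : r.*2.+2 < M by rewrite /scale; lia.
pose i0 := Ordinal h0; pose i1 := Ordinal h1; pose i2 := Ordinal h2.
have n01 : near_nat r i0 i1 = false by rewrite /near_nat /=; lia.
have n02 : near_nat r i0 i2 = false by rewrite /near_nat /=; lia.
have n12 : near_nat r i1 i2 = false by rewrite /near_nat /=; lia.
move=> hP hQ; apply/existsP; apply: contraT; rewrite negb_exists => /forallP h.
have := h i0; have := h i1; have := h i2.
have := hP i0 i1; have := hP i0 i2; have := hP i1 i2.
have := hQ i0 i1; have := hQ i0 i2; have := hQ i1 i2.
rewrite n01 n02 n12.
by case: (P i0) (P i1) (P i2) (Q i0) (Q i1) (Q i2)
  => [] [] [] [] [] [] //=; do ?[move=> /(_ isT isT) // | move=> _].
Qed.

Lemma common_good_row j z z' : good_block j.+1 z -> good_block j.+1 z' ->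
  exists b : 'I_M, good_row j z b && good_row j z' b.
Proof. by move=> gz gz'; apply: common_index => a b; exact: good_rowN_near. Qed.

Lemma common_good_col j z z' : good_block j.+1 z -> good_block j.+1 z' ->
  exists a : 'I_M, good_col j z a && good_col j z' a.
Proof. by move=> gz gz'; apply: common_index => a b; exact: good_colN_near. Qed.

Lemma scale_gt0 : 0 < M. Proof. by []. Qed.

Lemma core_nonempty j z : good_block j z -> exists x, core j z x.
Proof.
elim: j z => [|j IH] z gz; first by exists z.
have [b /andP[rb _]] := common_good_row gz gz.
have /forallP/(_ (Ordinal scale_gt0))/IH[x hx] := rb.
by exists x, (Ordinal scale_gt0), b; rewrite rb.
Qed.

Lemma core_ge j z x : core j z x -> M ^ j * z.1 <= x.1.
Proof.
elim: j z => [|j IH] z /=; first by move=> ->; rewrite mul1n.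
by move=> [a [b [_ /IH /=]]]; rewrite expnS; nia.
Qed.

Lemma core_subblock0 j z : good_row j z 0 -> 
  forall x, core j (subblock r z 0 0) x -> core j.+1 z x.
Proof.
by move=> h x hx; exists (Ordinal scale_gt0), (Ordinal scale_gt0); rewrite h.
Qed.

Section connectivity.
(** Later the relation that the images in Z^n are joined by open sites; an abstract [R] keeps the
    multi-scale induction free of the lattice. *)
Variable R : nat * nat -> nat * nat -> Prop.
Hypothesis Rsym : forall x y, R x y -> R y x.
Hypothesis Rtrans : forall x y z, R x y -> R y z -> R x z.
Hypothesis Rgood : forall z, g z ->
  [/\ R z z, R z (z.1.+1, z.2) & R z (z.1, z.2.+1)].

Let linked j z z' := forall x y, core j z x -> core j z' y -> R x y.

Let linked_sym j z z' : linked j z z' -> linked j z' z.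
Proof. by move=> h x y cx cy; apply/Rsym/h. Qed.

(** Goodness of the middle block gives its core a point to pass through; with an empty core both
    links would be vacuous. *)
Let linked_trans j z z' z'' : good_block j z' ->
  linked j z z' -> linked j z' z'' -> linked j z z''.
Proof.
move=> /core_nonempty[u cu] h h' x y cx cy.
exact: Rtrans (h _ _ cx cu) (h' _ _ cu cy).
Qed.

Let linked_step j := forall z, good_block j z ->
  [/\ linked j z z,
      good_block j (z.1.+1, z.2) -> linked j z (z.1.+1, z.2) &
      good_block j (z.1, z.2.+1) -> linked j z (z.1, z.2.+1)].

Section induction_step.
Variable j : nat.
Hypothesis IH : linked_step j.

Lemma linked_row z (b a a' : 'I_M) : good_row j z b ->
  linked j (subblock r z a b) (subblock r z a' b).
Proof.
move=> /forallP h.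
(* By symmetry it suffices to move to the right, by induction on the number of steps. *)
suff H (c c' : nat) : c + c' < M ->
    linked j (subblock r z c b) (subblock r z (c + c') b).
  case: (leqP a a') => [/subnKC e|/ltnW/subnKC e].
  - by rewrite -e; apply: H; rewrite e.
  - by apply: linked_sym; rewrite -e; apply: H; rewrite e.
elim: c' => [|c' IHc] lt.
  rewrite addn0 in lt *.
  by have [] := IH (h (Ordinal lt)).
have lt' : c + c' < M by lia.
apply: linked_trans (h (Ordinal lt')) (IHc lt') _ => /=.
have [_ + _] := IH (h (Ordinal lt')).
rewrite /subblock /= -!addnS; apply.
exact: (h (Ordinal lt)).
Qed.

Lemma linked_col z (a b b' : 'I_M) : good_col j z a ->
  linked j (subblock r z a b) (subblock r z a b').
Proof.
move=> /forallP h.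
suff H (c c' : nat) : c + c' < M ->
    linked j (subblock r z a c) (subblock r z a (c + c')).
  case: (leqP b b') => [/subnKC e|/ltnW/subnKC e].
  - by rewrite -e; apply: H; rewrite e.
  - by apply: linked_sym; rewrite -e; apply: H; rewrite e.
elim: c' => [|c' IHc] lt.
  rewrite addn0 in lt *.
  by have [] := IH (h (Ordinal lt)).
have lt' : c + c' < M by lia.
apply: linked_trans (h (Ordinal lt')) (IHc lt') _ => /=.
have [_ _] := IH (h (Ordinal lt')).
rewrite /subblock /= -!addnS; apply.
exact: (h (Ordinal lt)).
Qed.

(** Follow the good row (or column) of the sub-block to its crossing with column [a0] (or row [b0]),
    then follow that line to the hub [(a0, b0)]. *)
Lemma linked_hub z (a0 b0 a b : 'I_M) :
  good_row j z b0 -> good_col j z a0 -> good_row j z b || good_col j z a ->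
  linked j (subblock r z a b) (subblock r z a0 b0).
Proof.
move=> r0 c0 /orP[rb|ca].
- apply: (@linked_trans _ _ (subblock r z a0 b)).
  + by have /forallP := c0; apply.
  + exact: linked_row.
  + exact: linked_col.
- apply: (@linked_trans _ _ (subblock r z a b0)).
  + by have /forallP := r0; apply.
  + exact: linked_col.
  + exact: linked_row.
Qed.

(** Each sub-block of a core is linked to the hub of its block, so a single link between two hubs
    joins the whole cores. *)
Lemma linked_hubs z z' (a b a' b' : 'I_M) :
  good_row j z b -> good_col j z a -> good_row j z' b' -> good_col j z' a' ->
  linked j (subblock r z a b) (subblock r z' a' b') -> linked j.+1 z z'.
Proof.
move=> rb ca rb' ca' l x y [c [d [h cx]]] [c' [d' [h' cy]]].
apply: (linked_trans _ _ _ cx cy).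
- by have /forallP/(_ a) := rb; apply.
- exact: linked_hub.
- apply: linked_trans l (linked_sym _).
  + by have /forallP/(_ a') := rb'; apply.
  + exact: linked_hub.
Qed.

Lemma linked_stepS : linked_step j.+1.
Proof.
move=> z gz.
have [b0 /andP[rb0 _]] := common_good_row gz gz.
have [a0 /andP[ca0 _]] := common_good_col gz gz.
split=> [|gz'|gz'].
- by apply: (linked_hubs rb0 ca0 rb0 ca0); apply: linked_row.
(* A row that is good in both blocks crosses their common side: its last sub-block in [z] and its
   first one in the right neighbour are adjacent at level [j]. *)
- have [b /andP[rb rb']] := common_good_row gz gz'.
  have [a /andP[ca _]] := common_good_col gz' gz'.
  have gl : good_block j (subblock r z (@ord_max r.*2.+2) b).
    by have /forallP := rb; apply.
  have gr : good_block j (subblock r (z.1.+1, z.2) (Ordinal scale_gt0) b).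
    by have /forallP := rb'; apply.
  have e : subblock r (z.1.+1, z.2) 0 b =
    ((subblock r z (@ord_max r.*2.+2) b).1.+1,
     (subblock r z (@ord_max r.*2.+2) b).2).
    by rewrite /subblock /=; congr pair; rewrite /scale; lia.
  apply: (linked_hubs rb ca0 rb' ca).
  apply: (linked_trans gl); first exact: linked_row.
  apply: (linked_trans gr); last exact: linked_row.
  rewrite /= e; have [_ + _] := IH gl; apply.
  by rewrite -e.
- have [a /andP[ca ca']] := common_good_col gz gz'.
  have [b /andP[rb _]] := common_good_row gz' gz'.
  have gl : good_block j (subblock r z a (@ord_max r.*2.+2)).
    by have /forallP := ca; apply.
  have gr : good_block j (subblock r (z.1, z.2.+1) a (Ordinal scale_gt0)).
    by have /forallP := ca'; apply.
  have e : subblock r (z.1, z.2.+1) a 0 =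
    ((subblock r z a (@ord_max r.*2.+2)).1,
     (subblock r z a (@ord_max r.*2.+2)).2.+1).
    by rewrite /subblock /=; congr pair; rewrite /scale; lia.
  apply: (linked_hubs rb0 ca rb ca').
  apply: (linked_trans gl); first exact: linked_col.
  apply: (linked_trans gr); last exact: linked_col.
  rewrite /= e; have [_ _] := IH gl; apply.
  by rewrite -e.
Qed.

End induction_step.

Lemma good_block_linked j z x y : good_block j z ->
  core j z x -> core j z y -> R x y.
Proof.
suff H : linked_step j by move=> /H[h _ _]; exact: h.
elim: j => [|j IH]; last exact: linked_stepS.
move=> u /Rgood[h1 h2 h3].
by split=> [|_|_] v w -> ->.
Qed.

(** The bottom row of the block at the origin is good at every level, so by induction [(0, 0)] lies
    in all the cores. The block [(1, 0)] of level [N] sits in that row at level [N.+1], and its core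
    has first coordinates at least [M ^ N], hence at least [N]. *)
Lemma good_corner_linked :
  (forall j a, a < M -> good_block j (a, 0)) ->
  forall N : nat, exists2 x : nat * nat, N <= x.1 & R (0, 0) x.
Proof.
move=> h N.
have row0 j : good_row j (0, 0) 0.
  by apply/forallP => a; rewrite /subblock /= muln0 !add0n; apply: h.
have core0 j : core j (0, 0) (0, 0).
  elim: j => [//|j IH]; apply: core_subblock0 => //.
  by rewrite /subblock /= muln0.
have lt1 : 1 < M by rewrite /scale; lia.
have [x hx] := core_nonempty (h N 1 lt1).
exists x.
  have := core_ge hx; rewrite /= muln1; apply: leq_trans.
  by apply: ltnW; apply: ltn_expl.
apply: (@good_block_linked N.+1 (0, 0)) => //.
  exact: h.
exists (Ordinal lt1), (Ordinal scale_gt0); split.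
  by rewrite row0.
by rewrite /subblock /= muln0.
Qed.

End connectivity.
End good_blocks.

(** * Candidate certificates of badness: their number, size and distinct keys *)

Section bad_witnesses.
Variables (r : nat) (K : eqType) (keys : nat * nat -> seq K).
Local Notation M := (scale r).

(** The candidates do not depend on the configuration. A bad point has a closed key; a bad block has
    two bad sub-blocks far apart, whose certificates are concatenated. *)
Fixpoint bad_witnesses (j : nat) (z : nat * nat) : seq (seq K) :=
  if j is j'.+1 then
    flatten
      [seq [seq s ++ s' | s <- bad_witnesses j' (subblock r z p.1.1 p.1.2),
                          s' <- bad_witnesses j' (subblock r z p.2.1 p.2.2)]
        | p : ('I_M * 'I_M) * ('I_M * 'I_M)
            <- enum {: ('I_M * 'I_M) * ('I_M * 'I_M)}
        & ~~ near_block r (val p.1.1, val p.1.2) (val p.2.1, val p.2.2)]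
  else [seq [:: q] | q <- keys z].

(** There are [M ^ 4] ordered pairs of sub-blocks, and one candidate is chosen for each member of
    the pair. *)
Fixpoint witness_count (C j : nat) : nat :=
  if j is j'.+1 then M ^ 4 * witness_count C j' ^ 2 else C.

Lemma bad_witnessesSP j z s : s \in bad_witnesses j.+1 z ->
  exists (u v : 'I_M * 'I_M) (s1 s2 : seq K),
    [/\ ~~ near_block r (val u.1, val u.2) (val v.1, val v.2),
        s1 \in bad_witnesses j (subblock r z u.1 u.2),
        s2 \in bad_witnesses j (subblock r z v.1 v.2) & s = s1 ++ s2].
Proof.
move=> /flatten_mapP[[u v]]; rewrite mem_filter /= => /andP[h _].
by move=> /allpairsP[[s1 s2] [/= h1 h2 ->]]; exists u, v, s1, s2.
Qed.

Lemma bad_block_witness (open : pred K) j z :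
  ~~ good_block r (fun x => all open (keys x)) j z ->
  has (all (predC open)) (bad_witnesses j z).
Proof.
elim: j z => [|j IH] z.
  move=> /allPn[q qz oq]; apply/hasP; exists [:: q]; first by apply: map_f.
  by rewrite /= oq.
move=> /forallPn[u /forallPn[v]]; rewrite !negb_or => /and3P[].
move=> /IH/hasP[s1 h1 b1] /IH/hasP[s2 h2 b2] h.
apply/hasP; exists (s1 ++ s2); last by rewrite all_cat b1.
apply/flatten_mapP; exists (u, v); first by rewrite mem_filter h mem_enum.
exact: allpairs_f.
Qed.

Lemma bad_witness_size j z s : s \in bad_witnesses j z -> size s = 2 ^ j.
Proof.
elim: j z s => [|j IH] z s; first by move=> /mapP[q _ ->].
move=> /bad_witnessesSP[u [v [s1 [s2 [_ /IH h1 /IH h2 ->]]]]].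
by rewrite size_cat h1 h2 addnn -mul2n expnS.
Qed.

Lemma size_bad_witnesses (C : nat) j z : (forall x, size (keys x) <= C) ->
  size (bad_witnesses j z) <= witness_count C j.
Proof.
move=> hC; elim: j z => [|j IH] z; first by rewrite size_map.
rewrite size_flatten /shape -map_comp sumnE big_map.
apply: (@leq_trans (\sum_(p <- enum {: ('I_M * 'I_M) * ('I_M * 'I_M)} |
    ~~ near_block r (val p.1.1, val p.1.2) (val p.2.1, val p.2.2))
    witness_count C j ^ 2)).
  by rewrite big_filter; apply: leq_sum => p _; rewrite /= size_allpairs leq_mul.
rewrite big_const_seq iter_addn_0 mulnC leq_mul2r; apply/orP; right.
apply: leq_trans (count_size _ _) _.
by rewrite -cardE !card_prod card_ord -mulnA.
Qed.

Lemma bad_witness_keys j z s q : s \in bad_witnesses j z -> q \in s ->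
  exists x, [/\ q \in keys x, M ^ j * z.1 <= x.1 < M ^ j * z.1.+1 &
                M ^ j * z.2 <= x.2 < M ^ j * z.2.+1].
Proof.
elim: j z s => [|j IH] z s.
  move=> /mapP[q' qz ->]; rewrite inE => /eqP ->.
  by exists z; split=> //; lia.
move=> /bad_witnessesSP[u [v [s1 [s2 [_ h1 h2 ->]]]]]; rewrite mem_cat.
have H (a b : 'I_M) x :
  M ^ j * (M * z.1 + a) <= x.1 < M ^ j * (M * z.1 + a).+1 ->
  M ^ j * (M * z.2 + b) <= x.2 < M ^ j * (M * z.2 + b).+1 ->
  (M ^ j.+1 * z.1 <= x.1 < M ^ j.+1 * z.1.+1) /\
  (M ^ j.+1 * z.2 <= x.2 < M ^ j.+1 * z.2.+1).
  by rewrite expnS; have := ltn_ord a; have := ltn_ord b; nia.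
case/orP => [/(IH _ _ h1)|/(IH _ _ h2)] [x [qx /H h /h{h}[]]].
- by exists x; split.
- by exists x; split.
Qed.

(** If [b] is at least [a + r + 1], then [y - x] is at least [m * r + 1], which exceeds [r]; the
    other case is symmetric. *)
Lemma far_blocks (m a b x y : nat) : 0 < m -> ~~ near_nat r a b ->
  m * a <= x < m * a.+1 -> m * b <= y < m * b.+1 -> ~~ near_nat r x y.
Proof. by rewrite /near_nat; nia. Qed.

Lemma near_nat_shift c a b : near_nat r (c + a) (c + b) = near_nat r a b.
Proof. by rewrite /near_nat; lia. Qed.

(** A key common to both halves would belong to two points at distance at most [r], although these
    points lie in sub-blocks that are far apart. *)
Lemma bad_witness_uniq j z s :
  (forall x y q, q \in keys x -> q \in keys y -> near_block r x y) ->
  s \in bad_witnesses j z -> uniq s.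
Proof.
move=> hK; elim: j z s => [|j IH] z s; first by move=> /mapP[q _ ->].
move=> /bad_witnessesSP[u [v [s1 [s2 [far h1 h2 ->]]]]].
rewrite cat_uniq (IH _ _ h1) (IH _ _ h2) andbT /=; apply/hasPn => q q2.
apply: contra far => q1.
have [x [qx x1 x2]] := bad_witness_keys h1 q1.
have [y [qy y1 y2]] := bad_witness_keys h2 q2.
have /andP[n1 n2] := hK _ _ _ qx qy.
have M0 : 0 < M ^ j by rewrite expn_gt0.
apply/andP; split.
- rewrite -(near_nat_shift (M * z.1)).
  by apply: contraTT n1 => n1; exact: far_blocks M0 n1 x1 y1.
- rewrite -(near_nat_shift (M * z.2)).
  by apply: contraTT n2 => n2; exact: far_blocks M0 n2 x2 y2.
Qed.

End bad_witnesses.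

Local Open Scope classical_set_scope.
Local Open Scope ring_scope.

(** * Walks, open clusters and boxes in Z^n *)

Section lattice.
Variable n : nat.
Implicit Types (x y v : 'rV[int]_n) (eta : 'rV[int]_n -> bool).

Definition unit_vector (i : 'I_n) : 'rV[int]_n := delta_mx 0 i.

Definition neighbours x : seq 'rV[int]_n :=
  [seq x + unit_vector i | i <- enum 'I_n] ++
  [seq x - unit_vector i | i <- enum 'I_n].

Lemma unit_vectorE (i j : 'I_n) : unit_vector i 0 j = (j == i)%:R.
Proof. by rewrite mxE eqxx. Qed.

Lemma size_neighbours x : size (neighbours x) = (2 * n)%N.
Proof.
by rewrite size_cat size_map size_enum_ord size_map size_enum_ord addnn -mul2n.
Qed.

(** When integer squares sum to 1, a nonzero one equals 1 and the others vanish. *)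
Lemma adjacent_neighbours x y : site_adjacent x y -> y \in neighbours x.
Proof.
rewrite /site_adjacent => /eqP s1.
have [i xyi] : exists i, x 0 i - y 0 i != 0.
  apply/existsP; apply: contra_eqT s1; rewrite negb_exists => /forallP h.
  by rewrite big1// => i _; have := h i; rewrite negbK => /eqP ->.
move: s1; rewrite (bigD1 i)//=.
set S := \sum_(_ < _ | _) _ => s1.
have S0 : 0 <= S by apply: sumr_ge0 => j _; exact: sqr_ge0.
have {s1}[di Se] : (x 0 i - y 0 i) ^+ 2 = 1 /\ S = 0.
  by move: xyi S0 s1; rewrite expr2; nia.
have e (j : 'I_n) : j != i -> y 0 j = x 0 j.
  move: Se => /eqP; rewrite psumr_eq0; last by move=> *; exact: sqr_ge0.
  move=> /allP/(_ j (mem_index_enum _)) /implyP h /h.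
  by rewrite sqrf_eq0 subr_eq0 => /eqP.
move: di => /eqP; rewrite sqrf_eq1 mem_cat => /orP[|] /eqP di; apply/orP.
- right; apply/mapP; exists i; rewrite ?mem_enum//.
  apply/rowP => j; rewrite 2!mxE unit_vectorE.
  by have [->|/e ->] := eqVneq j i; rewrite ?subr0// -di subKr.
- left; apply/mapP; exists i; rewrite ?mem_enum//.
  apply/rowP => j; rewrite mxE unit_vectorE.
  have [->|/e ->] := eqVneq j i; rewrite ?addr0//.
  by rewrite -[1]opprK -di opprB addrC subrK.
Qed.

Lemma site_adjacent_unit x i : site_adjacent x (x + unit_vector i).
Proof.
rewrite /site_adjacent (bigD1 i)//= big1 ?addr0 => [|j /negbTE ji].
  by rewrite mxE unit_vectorE eqxx opprD addNKr sqrrN expr1n.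
by rewrite mxE unit_vectorE ji addr0 subrr expr0n.
Qed.

Lemma site_adjacent_sym x y : site_adjacent x y = site_adjacent y x.
Proof.
by rewrite /site_adjacent; under eq_bigr do rewrite -sqrrN opprB.
Qed.

Lemma site_adjacentP x y :
  site_adjacent x y = (y \in neighbours x).
Proof.
apply/idP/idP; first exact: adjacent_neighbours.
rewrite mem_cat => /orP[] /mapP[i _ ->]; first exact: site_adjacent_unit.
by rewrite site_adjacent_sym -{2}(subrK (unit_vector i) x) site_adjacent_unit.
Qed.

(** As in [path], a walk is recorded without its starting point. *)
Fixpoint walks (N : nat) x : seq (seq 'rV[int]_n) :=
  if N is N'.+1 then [seq y :: s | y <- neighbours x, s <- walks N' y]
  else [:: [::]].

Lemma size_walks N x : size (walks N x) = ((2 * n) ^ N)%N.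
Proof.
elim: N x => [//|N IH] x /=.
rewrite size_allpairs_dep -(size_neighbours x) expnS.
under eq_map do rewrite IH.
by rewrite sumnE big_map big_const_seq iter_addn_0 count_predT mulnC
  size_neighbours.
Qed.

Lemma mem_walks x s : path (@site_adjacent n) x s -> s \in walks (size s) x.
Proof.
elim: s x => [//|y s IH] x /= /andP[xy ys].
by apply/allpairsPdep; exists y, s; rewrite -site_adjacentP xy IH.
Qed.

Lemma size_walk N x s : s \in walks N x -> size s = N.
Proof.
elim: N x s => [|N IH] x s /=; first by rewrite inE => /eqP ->.
by move=> /allpairsPdep[y [s' [_ /IH <- ->]]].
Qed.

Definition radius x : nat := \max_(i < n) `|x 0%R i|%N.

Lemma infinite_setP_radius (A : set 'rV[int]_n) :
  infinite_set A <-> forall N, exists2 y, A y & (N <= radius y)%N.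
Proof.
split=> [Ainf N|h /finite_seqP[s sA]].
  apply: contrapT => h; apply: Ainf.
  (* Coordinates of absolute value less than [N] become elements of ['I_(N.*2)] after a shift by
     [N], so sites of radius less than [N] are finitely many. *)
  pose F (f : {ffun 'I_n -> 'I_(N.*2)}) : 'rV[int]_n :=
    \row_i ((f i)%:Z - N%:Z).
  apply: (@sub_finite_set _ _ (range F)); last exact/finite_image/finite_finset.
  move=> y Ay.
  have yN i : (`|y 0%R i| < N)%N.
    rewrite ltnNge; apply/negP => Ny; apply: h; exists y => //.
    exact: leq_trans Ny (leq_bigmax _).
  have lt i : (`|(y 0 i + N%:Z)%R|%N < N.*2)%N by have := yN i; lia.
  exists [ffun i => Ordinal (lt i)] => //.
  by apply/rowP => i; rewrite mxE ffunE /=; have := yN i; lia.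
have [y] := h (\max_(x <- s) radius x).+1.
by rewrite sA /= => ys; rewrite ltnNge leq_bigmax_seq.
Qed.

Lemma radius_walk x s i : path (@site_adjacent n) x s ->
  (`|last x s 0%R i| <= `|x 0%R i| + size s)%N.
Proof.
elim: s x => [|y s IH] x /=; first by rewrite addn0.
rewrite site_adjacentP mem_cat => /andP[xy /IH h]; apply: leq_trans h _.
rewrite addnS -addSn leq_add2r.
by case/orP: xy => /mapP[j _ ->]; rewrite !mxE; case: (_ && _) => /=; lia.
Qed.

Lemma open_cluster_sym eta x y : open_cluster eta x y -> open_cluster eta y x.
Proof.
move=> [s [xs <- os]]; exists (rev (belast x s)); split.
- rewrite rev_path (eq_path (e' := @site_adjacent n))// => u v.
  exact: site_adjacent_sym.
- by case: s {xs os} => [//|z s]; rewrite /= rev_cons last_rcons.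
- by rewrite -rev_rcons -lastI all_rev.
Qed.

Lemma open_cluster_trans eta x y z :
  open_cluster eta x y -> open_cluster eta y z -> open_cluster eta x z.
Proof.
move=> [s [xs <- os]] [s' [ys <- os']].
exists (s ++ s'); rewrite cat_path xs ys last_cat; split => //.
by rewrite -cat_cons all_cat os; case/andP: os'.
Qed.

Definition nat_row (w : 'I_n -> nat) : 'rV[int]_n := \row_i (w i)%:Z.

(* A monotone lattice path stays in the box spanned by its endpoints. *)
Lemma open_cluster_box eta x (w : 'I_n -> nat) :
  (forall v : 'I_n -> nat, (forall i, v i <= w i)%N -> eta (x + nat_row v)) ->
  open_cluster eta x (x + nat_row w).
Proof.
have [m] := ubnP (\sum_i w i)%N; elim: m w => // m IH w wm ow.
have [/forallP w0|/forallPn[i wi]] := boolP [forall i, w i == 0%N].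
  have e : x + nat_row w = x.
    by apply/rowP => i; rewrite !mxE (eqP (w0 i)) addr0.
  by rewrite e; exists [::]; split; rewrite //= -e ow.
(* One unit step in direction [i] is removed; the subtraction does not truncate, as [w i] is
   nonzero. *)
pose w' j := (w j - (j == i))%N.
have ww' j : (w' j <= w j)%N by rewrite leq_subr.
apply: (@open_cluster_trans _ _ (x + nat_row w')).
  apply: IH => [|v vw']; last by apply: ow => j; exact: leq_trans (vw' j) _.
  have -> : (\sum_i w' i)%N = (\sum_i w i - 1)%N.
    rewrite (bigD1 i)//= [in RHS](bigD1 i)//= /w' eqxx.
    under eq_bigr => j /negbTE -> do rewrite subn0.
    by rewrite addnBAC// lt0n.
  have : (0 < \sum_i w i)%N by rewrite (bigD1 i)//= addn_gt0 lt0n wi.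
  lia.
have e : x + nat_row w = x + nat_row w' + unit_vector i.
  apply/rowP => j; rewrite !mxE eqxx /= -addrA; congr (_ + _).
  by rewrite /w'; have [->|_] := eqVneq j i => /=; lia.
exists [:: x + nat_row w]; split => //=; last by rewrite !ow.
by rewrite e site_adjacent_unit.
Qed.

End lattice.

(** * Projected walks and the embedded quarter plane, for a fixed configuration *)

Section hyperplanes.
Variables (k n : nat).

(* The pair (I, v) names the variable omega_I(pi_I(v)); it is in normal form
   when v is fixed by pi_I. *)
Local Notation site_key := (ksubset k n * 'rV[int]_n)%type.

Definition project_key (I : ksubset k n) (v : 'rV[int]_n) :
    site_key :=
  (I, val (coord_proj (val I) v)).

Definition normal_key (q : site_key) :=
  supported (val q.1) q.2.

Lemma coord_projK (I : {set 'I_n}) (v : 'rV[int]_n) :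
  supported I v -> val (coord_proj I v) = v.
Proof.
move=> /forallP Iv; apply/rowP => i; rewrite mxE.
by have := Iv i; case: (i \in I) => //= /eqP ->.
Qed.

Lemma coord_proj_idem (I : {set 'I_n}) (v : 'rV[int]_n) :
  coord_proj I (val (coord_proj I v)) = coord_proj I v.
Proof. by apply/val_inj/coord_projK/supported_coord_proj. Qed.

Section configuration.
Variable o : forall I : ksubset k n, sublattice (val I) -> bool.

(** Projecting again makes this total on pairs; on normal keys the projection changes nothing, and
    distinct normal keys name distinct variables. *)
Definition open_key (q : site_key) : bool :=
  o (coord_proj (val q.1) q.2).

Definition configuration (v : 'rV[int]_n) : bool :=
  \big[andb/true]_(I : ksubset k n) o (coord_proj (val I) v).

Lemma configurationP v :
  reflect (forall I, open_key (project_key I v)) (configuration v).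
Proof.
rewrite /configuration big_andE; apply: (iffP forallP) => h I.
  by rewrite /open_key /= coord_proj_idem; exact: h.
by have := h I; rewrite /open_key /= coord_proj_idem.
Qed.

Lemma ksubset_containing (i : 'I_n) : (0 < k <= n)%N ->
  exists I : ksubset k n, i \in val I.
Proof.
(* With [i] listed first, the first [k] entries form the required subset. *)
move=> /andP[k0 kn]; pose s := i :: rem i (enum 'I_n).
have sE : perm_eq (enum 'I_n) s by rewrite perm_to_rem ?mem_enum.
have us : uniq s by rewrite -(perm_uniq sE) enum_uniq.
have szs : size s = n by rewrite -(perm_size sE) size_enum_ord.
have c : #|[set x in take k s]%SET| == k.
  by rewrite cardsE (card_uniqP _) ?take_uniq// size_take_min szs; apply/eqP/minn_idPl.
exists (exist (fun J : {set 'I_n} => #|J| == k) _ c) => /=; rewrite inE.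
by case: (k) k0 => [//|k' _]; rewrite /= mem_head.
Qed.

(** The filter keeps self-avoiding walks inside the sublattice, whose [N.+1] keys name distinct
    variables. *)
Definition walk_keys (N : nat) :
    seq (seq site_key) :=
  [seq s <- [seq [seq (J, v) | v <- 0 :: w]
               | J : ksubset k n <- enum {: ksubset k n},
                 w : seq 'rV[int]_n <- walks N 0]
     | uniq s && all normal_key s].

Lemma size_walk_keys N :
  (size (walk_keys N) <= #|{: ksubset k n}| * (2 * n) ^ N)%N.
Proof.
rewrite size_filter; apply: leq_trans (count_size _ _) _.
by rewrite size_allpairs -cardE size_walks.
Qed.

Lemma walk_keysP N s : s \in walk_keys N ->
  [/\ uniq s, all normal_key s & size s = N.+1].
Proof.
rewrite mem_filter => /andP[/andP[us ns]] /allpairsP[[I w] [_ /= hw e]].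
by split; rewrite // e /= size_map (size_walk hw).
Qed.

(** Take an open path to a site with a coordinate [i] of size at least [N], and project it along
    some [I] containing [i]. Erasing loops and pauses leaves a self-avoiding walk with the same
    endpoints, hence with at least [N] steps; its first [N] are kept. *)
Lemma percolation_walk N : (0 < k <= n)%N -> origin_percolates configuration ->
  has (all open_key) (walk_keys N).
Proof.
move=> kn /infinite_setP_radius/(_ N)[y [s [xs ly os]] Ny].
have [i Nyi] : exists i : 'I_n, (N <= `|y 0%R i|)%N.
  case: (posnP n) => [n0|n0].
    lia.
  have c0 : (0 < #|'I_n|)%N by rewrite card_ord.
  by have [i yi] := bigop.eq_bigmax (fun i : 'I_n => `|y 0%R i|%N) c0;
    exists i; rewrite -yi.
have [I iI] := ksubset_containing i kn.
pose proj v := val (coord_proj (val I) v).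
pose e' u v := site_adjacent u v || (u == v :> 'rV[int]_n).
have proj_step u v : site_adjacent u v -> e' (proj u) (proj v).
  rewrite /e' !site_adjacentP mem_cat => uv.
  have [j] : exists j, v = u + unit_vector j \/ v = u - unit_vector j.
    by case/orP: uv => /mapP[j _ ->]; exists j; [left|right].
  have [jI|jI] := boolP (j \in val I).
    move=> h; apply/orP; left; rewrite mem_cat; apply/orP.
    case: h => ->; [left|right]; apply/mapP; exists j; rewrite ?mem_enum//;
      apply/rowP => l; rewrite !mxE; case: ifPn => // lI;
      by rewrite (_ : l == j = false) ?addr0 ?subr0//; apply: contraNF lI => /eqP ->.
  move=> h; apply/orP; right; apply/eqP/rowP => l.
  case: h => ->; rewrite !mxE; case: ifPn => // lI;
    by rewrite (_ : l == j = false) ?addr0 ?subr0//; apply: contraTF lI => /eqP ->.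
have path_e' : path e' (proj 0) (map proj s).
  rewrite path_map; apply: sub_path xs => u v; exact: proj_step.
have proj0 : proj 0 = 0.
  by apply/rowP => j; rewrite !mxE; case: ifP.
have : last 0 (map proj s) = proj y by rewrite -[0]proj0 last_map ly.
rewrite proj0 in path_e'; case/shortenP: path_e' => s' s'p us' ss' lastE.
have keyE v : v \in 0 :: s' -> normal_key (I, v) && open_key (I, v).
  move=> vs; have : v \in map proj (0 :: s).
    rewrite /= proj0; move: vs; rewrite !inE => /orP[->//|/ss' ->].
    by rewrite orbT.
  move=> /mapP[u us ->]; rewrite /normal_key supported_coord_proj /=.
  by have /allP/(_ _ us)/configurationP/(_ I) := os.
(* Without repeated sites no step can be a pause. *)
have adj_s' : path (@site_adjacent n) 0 s'.
  move: s'p us' {ss' lastE keyE}; elim: s' (0) => [//|v s' IH] u /=.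
  rewrite inE negb_or -!andbA => /andP[uv vs] /and3P[nuv _ us].
  rewrite IH//= ?andbT; first by case/orP: uv => // /eqP uv; rewrite uv eqxx in nuv.
have Ns' : (N <= size s')%N.
  have := radius_walk i adj_s'; rewrite lastE !mxE iI add0n.
  exact: leq_trans.
pose w := take N s'.
have wE : 0 :: w = take N.+1 (0 :: s') by [].
have uw : uniq (0 :: w) by rewrite wE take_uniq.
have ww v : v \in 0 :: w -> normal_key (I, v) && open_key (I, v).
  by rewrite wE => /mem_take; exact: keyE.
apply/hasP; exists [seq (I, v) | v <- 0 :: w]; last first.
  by apply/allP => _ /mapP[v /ww/andP[_ h] ->].
rewrite mem_filter map_inj_uniq; last by move=> ? ? [].
rewrite uw; apply/andP; split.
  by apply/allP => _ /mapP[v /ww/andP[h _] ->].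
apply/allpairsP; exists (I, w); split; rewrite ?mem_enum//=.
by rewrite -[in walks N](size_takel Ns') mem_walks// take_path.
Qed.

(* The image of the quarter plane under two vectors (1, ..., 1) and
   (0, 1, ..., n - 1), all of whose 2 x 2 minors are nonzero: the projections
   to the coordinate subspaces of dimension at least 2 are injective on it. *)
Definition embed (z : nat * nat) : 'rV[int]_n :=
  nat_row (fun i : 'I_n => z.1 + z.2 * i)%N.

Definition box_keys (z : nat * nat) : seq site_key :=
  [seq project_key J (embed z + nat_row (fun i => w i : nat))
    | J : ksubset k n <- enum {: ksubset k n},
        w : {ffun 'I_n -> 'I_n} <- enum {: {ffun 'I_n -> 'I_n}}].

Definition dependency_range : nat := (2 * n ^ 2)%N.

Lemma size_box_keys z :
  (size (box_keys z) <= #|{: ksubset k n}| * #|{: {ffun 'I_n -> 'I_n}}|)%N.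
Proof. by rewrite size_allpairs -!cardE. Qed.

Lemma box_keys_normal z q : q \in box_keys z -> normal_key q.
Proof. by move=> /allpairsP[[I w] [_ _ ->]]; exact: supported_coord_proj. Qed.

(** Compare the coordinates at two indices [i < j] of the common [I]. Subtracting the two equations
    bounds the difference of second coordinates by [2 * n]; either equation then bounds that of the
    first ones by [2 * n ^ 2]. *)
Lemma box_keys_near x y q : (2 <= k)%N ->
  q \in box_keys x -> q \in box_keys y -> near_block dependency_range x y.
Proof.
move=> k2 /allpairsP[[I w] [_ _ ->]] /allpairsP[[J v] [_ _]] /= [<- e].
have [i [j [iI jI ij]]] : exists i j, [/\ i \in val I, j \in val I & (i < j)%N].
  have : (1 < #|val I|)%N by rewrite (eqP (valP I)).
  move=> /card_gt1P[i [j [iI jI]]]; rewrite neq_ltn => /orP[ij|ij].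
    by exists i, j.
  by exists j, i.
have E l : l \in val I -> (x.1 + x.2 * l + w l = y.1 + y.2 * l + v l)%N.
  move=> lI; have := congr1 (fun u : 'rV[int]_n => u 0 l) e.
  by rewrite !mxE lI -!PoszD => -[].
have := E _ iI; have := E _ jI; rewrite /near_block /near_nat /dependency_range.
have := ltn_ord (w i); have := ltn_ord (w j).
have := ltn_ord (v i); have := ltn_ord (v j).
have := ltn_ord i; have := ltn_ord j; move: ij.
move: (w i) (w j) (v i) (v j) => /= a b c d.
rewrite -mulnn; nia.
Qed.

(** Both steps of the embedding, (1, ..., 1) and (0, 1, ..., n - 1), have entries below [n], so a
    monotone path from one image to the next stays in the open box. *)
Lemma embed_connected z : (1 < n)%N -> all open_key (box_keys z) ->
  [/\ open_cluster configuration (embed z) (embed z),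
      open_cluster configuration (embed z) (embed (z.1.+1, z.2)) &
      open_cluster configuration (embed z) (embed (z.1, z.2.+1))].
Proof.
move=> n1 /allP h.
have H (w : 'I_n -> nat) : (forall i, w i < n)%N ->
    open_cluster configuration (embed z) (embed z + nat_row w).
  move=> wn; apply: open_cluster_box => v vw; apply/configurationP => I.
  have vn i : (v i < n)%N by exact: leq_ltn_trans (vw i) (wn i).
  apply: h; apply/allpairsP; exists (I, [ffun i => Ordinal (vn i)]).
  split; rewrite ?mem_enum//=; congr (project_key _ (_ + _)).
  by apply/rowP => i; rewrite !mxE ffunE.
split.
- rewrite -{2}[embed z]addr0 (_ : 0 = nat_row (fun=> 0%N)).
    by apply: H => i; exact: leq_ltn_trans (ltn_ord i).
  by apply/rowP => i; rewrite !mxE.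
- rewrite (_ : embed (z.1.+1, _) = embed z + nat_row (fun=> 1%N)).
    exact: H.
  by apply/rowP => i; rewrite !mxE /=; lia.
- rewrite (_ : embed (z.1, z.2.+1) = embed z + nat_row (fun i => val i)).
    by apply: H => i; exact: ltn_ord.
  by apply/rowP => i; rewrite !mxE /=; lia.
Qed.

Lemma good_blocks_percolation : (1 < n)%N ->
  (forall j a, (a < scale dependency_range)%N ->
     good_block dependency_range (fun z => all open_key (box_keys z)) j (a, 0%N)) ->
  origin_percolates configuration.
Proof.
move=> n1 /good_corner_linked h; apply/infinite_setP_radius => N.
have [//|//||x Nx Rx] := h
  (fun x y => open_cluster configuration (embed x) (embed y)) _ _ _ N.
- by move=> x y; exact: open_cluster_sym.
- by move=> x y z; exact: open_cluster_trans.
- by move=> z; exact: embed_connected.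
have e0 : embed (0%N, 0%N) = 0 by apply/rowP => i; rewrite !mxE.
exists (embed x); first by rewrite -e0.
have n0 : (0 < n)%N by lia.
(* Coordinate 0 of [embed x] is [x.1], since the second vector vanishes there. *)
apply: leq_trans Nx _; apply: leq_trans (leq_bigmax (Ordinal n0)).
by rewrite mxE /= muln0 addn0.
Qed.

End configuration.
End hyperplanes.

(** * Finite intersections in generated sigma-algebras *)

Lemma g_sigma_setI (T : Type) (G : set (set T)) (A B : set T) :
  <<s G >> A -> <<s G >> B -> <<s G >> (A `&` B).
Proof.
move=> GA GB.
have -> : A `&` B = setT `\` \bigcup_i (bigcup2 (setT `\` A) (setT `\` B) i).
  by rewrite bigcup2E !setTD -setCI setCK.
apply: sigma_algebraCD; apply: sigma_algebra_bigcup => -[|[|i]] /=.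
- exact: sigma_algebraCD.
- exact: sigma_algebraCD.
- exact: sigma_algebra0.
Qed.

(** Puts an event on finitely many variables of one family into the sigma-algebra to which
    independence between families applies. *)
Lemma g_sigma_bigcap_seq (T : Type) (G : set (set T)) (J : choiceType) (s : seq J)
    (A : J -> set T) : (forall j, j \in s -> <<s G >> (A j)) ->
  <<s G >> (\bigcap_(j in [set` s]) A j).
Proof.
move=> h; rewrite bigcap_seq big_seq; apply: big_ind => //.
  have : <<s G >> (setT `\` set0).
    by apply: sigma_algebraCD; exact: sigma_algebra0.
  by rewrite setD0.
exact: g_sigma_setI.
Qed.

Lemma coord_proj_val (n : nat) (I : {set 'I_n}) (u : sublattice I) :
  coord_proj I (val u) = u.
Proof. by apply/val_inj/coord_projK; exact: valP. Qed.

(** * Probability bounds for prescribed values of finitely many variables *)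

Section environment.
Context d (T : measurableType d) (R : realType) (P : probability T R).
Variables (k n : nat) (p : ksubset k n -> R).
Variable omega : forall I : ksubset k n, sublattice (val I) -> {RV P >-> bool}.
Hypothesis p01 : forall I, 0 <= p I <= 1.
Hypothesis env : hyperplane_environment p omega.
Local Notation site_key := (ksubset k n * 'rV[int]_n)%type.

Definition sample (t : T) (I : ksubset k n) (u : sublattice (val I)) : bool :=
  omega u t.

Definition key_event (b : bool) (q : site_key) : set T :=
  omega (coord_proj (val q.1) q.2) @^-1` [set b].

Lemma measurable_key_event b q : measurable (key_event b q).
Proof. exact: measurable_funPTI. Qed.

Definition key_prob (b : bool) (I : ksubset k n) : R :=
  if b then p I else 1 - p I.

Lemma prob_key_event b q : P (key_event b q) = (key_prob b q.1)%:E.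
Proof.
have /(_ [set b]) := environment_bernoulli env (coord_proj (val q.1) q.2).
rewrite bernoulli_probE// => e.
have inb (x : bool) : (x \in [set b]) = (x == b).
  by apply/idP/eqP; rewrite inE.
rewrite [LHS]e !diracE !inb /key_prob.
by case: b {e inb} => /=; rewrite ?mule1 ?mule0 ?adde0 ?add0e.
Qed.

(** The value [true] serves open walks at small parameters, and [false] serves closed certificates
    at parameters close to 1. *)
Definition keys_event (b : bool) (s : seq site_key) : set T :=
  [set t | all (fun q => open_key (sample t) q == b) s].

Lemma keys_eventE b s : keys_event b s = \bigcap_(q in [set` s]) key_event b q.
Proof.
apply/seteqP; split=> t /= h.
  by move=> q /= qs; apply/eqP; have /allP := h; exact.
by apply/allP => q qs; apply/eqP; exact: h.
Qed.

Lemma measurable_keys_event b s : measurable (keys_event b s).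
Proof.
rewrite keys_eventE; apply: fin_bigcap_measurable => //.
by move=> q _; exact: measurable_key_event.
Qed.

Lemma sigma_RV_key_event b (I : ksubset k n) (u : sublattice (val I)) :
  sigma_RV (omega u) (omega u @^-1` [set b]).
Proof. by exists [set b] => //; rewrite setTI. Qed.

(** Group the keys by [I]: independence within each family evaluates a group, and independence
    between families multiplies the groups. *)
Lemma prob_keys_event_le b (c : R) (s : seq site_key) :
  (forall I, key_prob b I <= c) -> uniq s -> all (@normal_key k n) s ->
  (P (keys_event b s) <= (c ^+ size s)%:E)%E.
Proof.
move=> hc us ns.
pose sI I : seq (sublattice (val I)) :=
  [seq coord_proj (val I) q.2 | q <- s & q.1 == I].
pose A I (u : sublattice (val I)) : set T := omega u @^-1` [set b].
pose B I : set T := \bigcap_(u in [set` sI I]) A I u.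
have -> : keys_event b s = \bigcap_(I in [set` enum {: ksubset k n}]) B I.
  rewrite keys_eventE; apply/seteqP; split=> t h.
    move=> I _ _ /= /mapP[q + ->]; rewrite mem_filter => /andP[/eqP <- qs].
    exact: h.
  move=> q /= qs; apply: (h q.1); first by rewrite /= mem_enum.
  by apply/mapP; exists q; rewrite // mem_filter eqxx.
(* Normality makes the projection injective on the keys of one group. *)
have usI I : uniq (sI I).
  rewrite map_inj_in_uniq ?filter_uniq// => -[J u] [K v].
  rewrite !mem_filter /= => /andP[/eqP -> qs] /andP[/eqP -> rs] e.
  have /allP := ns; move=> nk.
  have := nk _ qs; have := nk _ rs; rewrite /normal_key /= => n1 n2.
  by rewrite -(coord_projK n1) -(coord_projK n2) e.
have PB I : P (B I) = (key_prob b I ^+ size (sI I))%:E.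
  rewrite (environment_indep env (usI I)); last first.
    by move=> u _; exact: sigma_RV_key_event.
  rewrite (eq_bigr (fun=> (key_prob b I)%:E)); last first.
    move=> u _; have := prob_key_event b (I, val u).
    by rewrite /key_event /= coord_proj_val.
  by rewrite prodEFin big_const_seq count_predT -Monoid.iteropE.
rewrite (environment_indep_families env) ?enum_uniq//; last first.
  move=> I _; apply: g_sigma_bigcap_seq => u _; apply: sub_gen_smallest.
  by exists u => //; exact: sigma_RV_key_event.
rewrite (eq_bigr _ (fun I _ => PB I)) prodEFin lee_fin.
(* The sizes of the groups add up to the length of [s]. *)
have -> : c ^+ size s = \prod_(I <- enum {: ksubset k n}) c ^+ size (sI I).
  rewrite prodrXr; congr (_ ^+ _); rewrite big_enum /=.
  rewrite -sum1_size (partition_big (fun q : site_key => q.1) predT)//=.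
  apply: eq_bigr => I _; rewrite size_map size_filter -sum1_count.
  done.
apply: ler_prod => I _.
have k0 : 0 <= key_prob b I.
  have /andP[pI0 pI1] := p01 I.
  by rewrite /key_prob; case: ifP => // _; rewrite subr_ge0.
by rewrite exprn_ge0//= lerXn2r// nnegrE (le_trans k0).
Qed.

Definition some_keys_event (b : bool) (L : seq (seq site_key)) : set T :=
  [set t | has (all (fun q => open_key (sample t) q == b)) L].

Lemma some_keys_eventE b L :
  some_keys_event b L = \big[setU/set0]_(s <- L) keys_event b s.
Proof.
elim: L => [|s L IH]; first by rewrite big_nil; apply/seteqP; split.
rewrite big_cons -IH; apply/seteqP; split=> t /=.
  by move=> /orP.
by move=> /orP.
Qed.

Lemma measurable_some_keys_event b L : measurable (some_keys_event b L).
Proof.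
rewrite some_keys_eventE; apply: bigsetU_measurable => s _.
exact: measurable_keys_event.
Qed.

Lemma prob_some_keys_event_le b (c : R) (m N : nat) (L : seq (seq site_key)) :
  0 <= c -> (forall I, key_prob b I <= c) ->
  (forall s, s \in L -> [/\ uniq s, all (@normal_key k n) s & size s = m]) ->
  (size L <= N)%N ->
  (P (some_keys_event b L) <= (N%:R * c ^+ m)%:E)%E.
Proof.
move=> c0 hc hL LN.
apply: (@le_trans _ _ ((size L)%:R * c ^+ m)%:E); last first.
  by rewrite lee_fin ler_wpM2r ?exprn_ge0// ler_nat.
elim: L {N LN} hL => [|s L IH] hL.
  rewrite some_keys_eventE big_nil measure0 lee_fin mul0r.
  exact: lexx.
rewrite some_keys_eventE big_cons -some_keys_eventE.
apply: le_trans (measureU2 _ _ _) _; [exact: measurable_keys_event| |].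
  exact: measurable_some_keys_event.
rewrite -[size _]/((size L).+1) -natr1 mulrDl mul1r EFinD addeC.
have [us ns sm] := hL _ (mem_head s L).
apply: leeD; first by rewrite -sm; exact: prob_keys_event_le.
by apply: IH => s' s'L; apply: hL; rewrite inE s'L orbT.
Qed.

(** * The percolation event: measurability and the two regimes *)

Definition percolation_event : set T :=
  [set t | origin_percolates (hyperplane_percolation omega t)].

Lemma measurable_open_site (v : 'rV[int]_n) :
  measurable [set t | hyperplane_percolation omega t v].
Proof.
have -> : [set t | hyperplane_percolation omega t v] =
    keys_event true [seq project_key J v | J <- enum {: ksubset k n}].
  apply/seteqP; split=> t /=.
    move=> /(configurationP (sample t) v) h; apply/allP => _ /mapP[I _ ->].
    by rewrite eqb_id; exact: h.
  move=> /allP h; apply/(configurationP (sample t) v) => I.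
  rewrite -[open_key _ _]eqb_id; apply: h.
  by apply: map_f; rewrite mem_enum.
exact: measurable_keys_event.
Qed.

(** Percolation means that for each [N] some open walk from 0 ends at radius at least [N], and
    finite walks are countably many. *)
Lemma measurable_percolation_event : measurable percolation_event.
Proof.
pose walk_event (N : nat) (s : seq 'rV[int]_n) : set T :=
  [set t | path (@site_adjacent n) 0 s && (N <= radius (last 0%R s))%N &&
     all (hyperplane_percolation omega t) (0 :: s)].
have -> : percolation_event = \bigcap_N \bigcup_s walk_event N s.
  apply/seteqP; split=> t /=.
    move=> /infinite_setP_radius h N _; have [y [s [ps ly os]] Ny] := h N.
    by exists s => //; rewrite /walk_event /= ps ly Ny; exact: os.
  move=> h; apply/infinite_setP_radius => N.
  have [s _ /andP[/andP[ps Ns] os]] := h N I.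
  by exists (last 0 s) => //; exists s.
apply: bigcapT_measurable => N.
apply: countable_bigcupT_measurable => [|s]; first exact: countableP.
(* The conditions on the walk itself are deterministic; if they fail, the event is empty. *)
rewrite /walk_event; case: (_ && _) => /=; last first.
  rewrite (_ : [set _ | _] = set0); first exact: measurable0.
  by apply/seteqP; split.
have -> : [set t | hyperplane_percolation omega t 0 &&
     all (hyperplane_percolation omega t) s] =
    \bigcap_(v in [set` 0 :: s]) [set t | hyperplane_percolation omega t v].
  apply/seteqP; split=> t /=.
    by move=> h v /= vs; have /allP := (h : all _ (0 :: s)); exact.
  by move=> h; apply/(@allP _ _ (0 :: s)) => v vs; exact: h.
by apply: fin_bigcap_measurable => // v _; exact: measurable_open_site.
Qed.

(** The union bound over walks gives K c (2 n c)^N, at most K c / 2^N, for every [N]. *)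
Lemma subcritical (c : R) : (0 < k <= n)%N -> 0 <= c ->
  (2 * n)%:R * c <= 2^-1 -> (forall I, p I <= c) ->
  P percolation_event = 0%E.
Proof.
move=> kn c0 nc pc.
set K := #|{: ksubset k n}|.
have bound N : (P percolation_event <= (K%:R * c * (2^-1) ^+ N)%:E)%E.
  apply: (@le_trans _ _ (P (some_keys_event true (walk_keys k n N)))).
    apply: le_measure; rewrite ?inE; first exact: measurable_percolation_event.
      exact: measurable_some_keys_event.
    move=> t /(@percolation_walk k n (sample t) N kn) /=; apply: sub_has => s.
    by apply: sub_all => q; rewrite eqb_id.
  apply: le_trans (@prob_some_keys_event_le true c _ _ _ c0 pc
    (@walk_keysP k n N) (size_walk_keys k n N)) _.
  rewrite lee_fin natrM natrX exprS -/K mulrACA -exprMn.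
  by rewrite ler_wpM2l ?mulr_ge0// lerXn2r ?nnegrE ?mulr_ge0.
apply/eqP; rewrite eq_le measure_ge0 andbT.
apply/lee_addgt0Pr => e e0; rewrite add0e.
have Kc : 0 <= K%:R * c by rewrite mulr_ge0.
have [N hN] : exists N : nat, K%:R * c * (2^-1) ^+ N <= e.
  have x0 : 0 <= K%:R * c / e by rewrite divr_ge0// ltW.
  (* This [N] exceeds K c / e and is itself below 2^N. *)
  exists (Num.bound (K%:R * c / e)).
  rewrite exprVn ler_pdivrMr ?exprn_gt0// [e * _]mulrC -ler_pdivrMr//.
  apply: le_trans (ltW (archi_boundP x0)) _.
  by rewrite -natrX ler_nat ltnW// ltn_expl.
by apply: le_trans (bound N) _; rewrite lee_fin.
Qed.

(** Squaring the bound at level [j] and multiplying by M^4 gives 1 / (2^(2j+4) M^4), which is at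
    most 1 / (2^(j+3) M^4). *)
Lemma witness_count_le (c : R) (C r j : nat) : 0 <= c ->
  C%:R * c <= ((4 * scale r ^ 4)%:R)^-1 ->
  (witness_count r C j)%:R * c ^+ (2 ^ j) <= ((2 ^ j.+2 * scale r ^ 4)%:R)^-1.
Proof.
move=> c0 hC; elim: j => [//|j IH].
set M := scale r in hC IH *.
have M0 : 0 < M%:R :> R by rewrite ltr0n.
rewrite /= -/M natrM natrX natrX [(2 ^ j.+1)%N]expnS mulnC exprM -mulrA -exprMn.
apply: (@le_trans _ _ (M%:R ^+ 4 * ((2 ^ j.+2 * M ^ 4)%:R^-1) ^+ 2)).
  rewrite ler_wpM2l ?exprn_ge0//.
  by rewrite lerXn2r// nnegrE ?invr_ge0// mulr_ge0// exprn_ge0.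
have M4 : (0 < M ^ 4)%N by rewrite expn_gt0.
rewrite -natrX !(expnS 2); move: (M ^ 4)%N M4 => m' m'0; rewrite !natrM.
set A : R := (2 ^ j)%:R; set m : R := m'%:R.
have A1 : 1 <= A by rewrite ler1n expn_gt0.
have A0 : 0 < A by exact: lt_le_trans A1.
have m0 : 0 < m by rewrite ltr0n.
have -> : m * (2 * (2 * A) * m)^-1 ^+ 2 = (16 * A ^+ 2 * m)^-1.
  by field; rewrite !gt_eqF.
rewrite lef_pV2 ?posrE; first by rewrite ler_pM2r//; nra.
- by rewrite !mulr_gt0.
- by rewrite !mulr_gt0.
Qed.

Lemma supercritical (c : R) : (2 <= k <= n)%N -> 0 <= c ->
  (#|{: ksubset k n}| * #|{: {ffun 'I_n -> 'I_n}}|)%:R * c <=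
     ((4 * scale (dependency_range n) ^ 4)%:R)^-1 ->
  (forall I, 1 - p I <= c) ->
  (0 < P percolation_event)%E.
Proof.
move=> /andP[k2 kn] c0 hc pc.
set C := (_ * _)%N in hc.
pose M := scale (dependency_range n).
pose bad j a : set T :=
  some_keys_event false (bad_witnesses (dependency_range n) (@box_keys k n) j (a, 0%N)).
pose F j : set T := \big[setU/set0]_(a < M) bad j a.
have mbad j a : measurable (bad j a) by exact: measurable_some_keys_event.
have mF j : measurable (F j) by apply: bigsetU_measurable.
have Pbad j a : (P (bad j a) <= ((2 ^ j.+2 * M ^ 4)%:R^-1)%:E)%E.
  apply: le_trans (@prob_some_keys_event_le false c (2 ^ j)
    (witness_count (dependency_range n) C j) _ c0 pc _ _) _.
  - move=> s hs; split.
    + by apply: bad_witness_uniq hs => x y q; exact: box_keys_near.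
    + apply/allP => q qs; have [x [qx _ _]] := bad_witness_keys hs qs.
      exact: box_keys_normal qx.
    + exact: bad_witness_size hs.
  - by apply: size_bad_witnesses => x; exact: size_box_keys.
  - by rewrite lee_fin; exact: witness_count_le.
(* The sum over the [M] blocks is absorbed by M^4. The bound has the form eps / 2^(j+1) with eps =
   1/2, and its series over all levels sums to eps. *)
have PF j : (P (F j) <= ((2^-1 : R) / (2 ^ j.+1)%:R)%:E)%E.
  apply: le_trans (Boole_inequality P (fun a _ => mbad j a)) _.
  apply: (@le_trans _ _ (\sum_(a < M) ((2 ^ j.+2 * M ^ 4)%:R^-1)%:E)%E).
    by apply: lee_sum => a _; exact: Pbad.
  rewrite sumEFin lee_fin sumr_const card_ord -[_ *+ M]mulr_natr -invfM -natrM -expnS.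
  rewrite natrM invfM -mulrA ler_piMr ?invr_ge0//.
  by rewrite ler_pdivrMl ?ltr0n ?expn_gt0// mulr1 ler_nat expnS leq_pmulr ?expn_gt0.
have PU : (P (\bigcup_j F j) <= (2^-1 : R)%:E)%E.
  apply: le_trans (measure_sigma_subadditive P mF _ (@subset_refl _ _)) _.
    exact: bigcupT_measurable.
  apply: le_trans (lee_nneseries _ (fun j _ => PF j)) _; first by [].
  by apply: epsilon_trick0; rewrite invr_ge0.
have sub : ~` (\bigcup_j F j) `<=` percolation_event.
  move=> t /= nF; apply: (@good_blocks_percolation k n (sample t)).
    exact: leq_trans k2 kn.
  move=> j a aM; apply: contraT => /bad_block_witness h; exfalso; apply: nF.
  exists j => //; rewrite /F -bigcup_mkord; exists a => //=.
  apply: sub_has h => s; apply: sub_all => q /=.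
  by rewrite eqbF_neg.
apply: (@lt_le_trans _ _ (P (~` (\bigcup_j F j)))); last first.
  apply: le_measure; rewrite ?inE//.
  - by apply: measurableC; exact: bigcupT_measurable.
  - exact: measurable_percolation_event.
rewrite probability_setC; last exact: bigcupT_measurable.
rewrite sube_gt0; apply: le_lt_trans PU _.
by rewrite lte_fin invf_lt1 ?ltr1n.
Qed.

End environment.

Theorem theorem1 (R : realType) (n k : nat)
    (hn : (3 <= n)%N) (hk : (2 <= k <= n - 1)%N) :
  exists delta : R, 0 < delta < 1 /\
    forall (d : measure_display) (T : measurableType d) (P : probability T R)
      (p : ksubset k n -> R)
      (omega : forall I : ksubset k n, sublattice (val I) -> {RV P >-> bool}),
      (forall I, 0 <= p I <= 1) ->
      hyperplane_environment p omega ->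
      ((forall I, 1 - delta < p I) ->
         (0 < P [set t | origin_percolates (hyperplane_percolation omega t)])%E)
      /\
      ((forall I, p I < delta) ->
         P [set t | origin_percolates (hyperplane_percolation omega t)] = 0%E).
Proof.
have /andP[k2 kn] : (2 <= k <= n)%N by lia.
set C := (#|{: ksubset k n}| * #|{: {ffun 'I_n -> 'I_n}}|)%N.
pose M4 := (4 * scale (dependency_range n) ^ 4)%N.
have M4_gt0 : (0 < M4)%N by rewrite muln_gt0 expn_gt0.
(* The factor [M4 * C.+1] ensures C / D <= 1 / M4 for large parameters, and [4 * n] ensures 2 n / D
   <= 1/2 for small ones; the successor keeps [D] positive. *)
pose D := (M4 * C.+1 * (4 * n))%N.
have D1 : (1 < D)%N by rewrite /D; nia.
have D0 : 0 < D%:R :> R by rewrite ltr0n; lia.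
exists D%:R^-1; split.
  by rewrite invr_gt0 D0 invf_lt1// ltr1n.
move=> d T P p omega p01 env; split=> hp.
- apply: (supercritical p01 env (c := D%:R^-1)).
  + by rewrite k2.
  + by rewrite invr_ge0.
  + rewrite -/C -/M4 ler_pdivrMr// mulrC ler_pdivlMr ?ltr0n//.
    by rewrite -natrM ler_nat /D; nia.
  + by move=> I; have := hp I; lra.
- apply: (subcritical p01 env (c := D%:R^-1)).
  + by rewrite kn andbT; lia.
  + by rewrite invr_ge0.
  + rewrite ler_pdivrMr// mulrC ler_pdivlMr//.
    by rewrite -natrM ler_nat /D; nia.
  + by move=> I; exact: ltW.
Qed.
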